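(* Let $G=(V_1\sqcup V_2,E)$ be a finite bipartite graph with edge weights $\lambda(e)\ge 0$. For each $i\in V_1$ create a new node $i'$, let $V_3=\{i':i\in V_1\}$, and let $G'$ be the bipartite graph with node partition $(V_1,\,V_2\cup V_3)$ and edge set $E'=E\cup\{\{i,i'\}:i\in V_1\}$. Let $V_4$ be a set of $\#V_2$ further new nodes, and let $G''$ be the bipartite graph with node partition $(V_1\cup V_4,\,V_2\cup V_3)$ and edge set $E''=E'\cup\{\{a,b\}:a\in V_4,\ b\in V_2\cup V_3\}$. In both graphs the edges in $E$ keep their weights and all new edges have weight 1. Then: (1) if $X'$ is drawn from the weighted perfect matching distribution on $G'$, then the restriction of $X'$ to $E$ is distributed according to the weighted matching distribution on $G$; (2) $G''$ is a balanced bipartite graph, and if $X''$ is drawn from the weighted perfect matching distribution on $G''$, then the restriction of $X''$ to $E$ is distributed according to the weighted matching distribution on $G$.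
   Context: In a bipartite graph with partition $(A,B)$ every edge has exactly one endpoint in $A$ and one in $B$; it is balanced if $\#A=\#B$. A configuration on edge set $E$ is $x\in\{0,1\}^E$, and the degree of a node $i$ under $x$ is the number of edges $e$ incident to $i$ with $x(e)=1$. A configuration is a matching if every node has degree at most 1 under $x$. For a bipartite graph with partition $(A,B)$ and $\#A\le\#B$, a configuration is a perfect matching if it is a matching and every node of $A$ has degree exactly 1 under $x$ (so when $\#A=\#B$ every node has degree exactly 1). The weighted matching (respectively weighted perfect matching) distribution with edge weights $\lambda$ assigns to each matching (respectively perfect matching) $x$ probability proportional to $\prod_{e:x(e)=1}\lambda(e)$ (empty product equal to 1), and probability 0 to all other configurations. *)

(* Defs.v *)
From mathcomp Require Import all_boot all_order all_algebra.

Set Implicit Arguments.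
Unset Strict Implicit.
Unset Printing Implicit Defensive.

Import Order.TTheory GRing.Theory Num.Theory.

Local Open Scope ring_scope.

(* A finite simple bipartite graph with node partition (lnode, rnode).  The   *)
(* two parts are separate types, so they are disjoint, and the edge {a, b} is *)
(* represented by the pair (a, b) whose first component is its left endpoint. *)
Record bigraph := Bigraph {
  lnode : finType;
  rnode : finType;
  edges : {set lnode * rnode}
}.

Definition node (G : bigraph) : finType := (lnode G + rnode G)%type.

Definition edge (G : bigraph) : finType :=
  {e : lnode G * rnode G | e \in edges G}.

Notation config G := {ffun edge G -> bool}.

Definition balanced (G : bigraph) : bool := #|lnode G| == #|rnode G|.

Definition incident (G : bigraph) (v : node G) (e : edge G) : bool :=
  match v with
  | inl a => (val e).1 == a
  | inr b => (val e).2 == b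
  end.

Definition degree (G : bigraph) (x : config G) (v : node G) : nat :=
  #|[set e : edge G | incident v e & x e]|.

Definition matching (G : bigraph) : pred (config G) :=
  fun x => [forall v : node G, (degree x v <= 1)%N].

(* Meant for graphs with #|lnode G| <= #|rnode G|: it is the left part that   *)
(* has to be saturated.                                                       *)
Definition perfect_matching (G : bigraph) : pred (config G) :=
  fun x => matching x && [forall a : lnode G, degree x (inl a) == 1%N].

Section Distributions.
Variable R : realFieldType.

Definition weight (G : bigraph) (lam : edge G -> R) (x : config G) : R :=
  \prod_(e : edge G | x e) lam e.

(* The probability mass function on configurations that is proportional to    *)
(* [weight lam] on S and vanishes outside S.  If the normalising constant is  *)
(* 0 this is the zero function, which is not a probability distribution.      *)
Definition weighted_distr (G : bigraph) (S : pred (config G))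
    (lam : edge G -> R) (x : config G) : R :=
  if S x then weight lam x / \sum_(y : config G | S y) weight lam y else 0.

Definition matching_distr (G : bigraph) (lam : edge G -> R) :
  config G -> R := weighted_distr (@matching G) lam.

Definition perfect_matching_distr (G : bigraph) (lam : edge G -> R) :
  config G -> R := weighted_distr (@perfect_matching G) lam.

(* The mass function of f X when X has mass function mu. *)
Definition pushforward (S T : finType) (f : S -> T) (mu : S -> R) (y : T) : R :=
  \sum_(x : S | f x == y) mu x.

(* Here and in [restrict], iota is the inclusion of the edge set of G in the  *)
(* edge set of a larger graph H.                                              *)
Definition extend_weight (G H : bigraph) (iota : edge G -> edge H)
    (lam : edge G -> R) (e' : edge H) : R :=
  if [pick e | iota e == e'] is Some e then lam e else 1.

End Distributions.

Definition restrict (G H : bigraph) (iota : edge G -> edge H) (x : config H) :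
  config G := [ffun e => x (iota e)].

(* The right node [inr i] is the new node attached to the left node i.        *)
Definition pendant (G : bigraph) : bigraph :=
  @Bigraph (lnode G) (rnode G + lnode G)%type
    ([set (e.1, inl e.2) | e in edges G] :|: [set (i, inr i) | i : lnode G]).

(* V4 is the set of new left nodes, each joined to every right node of        *)
(* [pendant G]; it is meant to have #|rnode G| elements.                      *)
Definition completion (G : bigraph) (V4 : finType) : bigraph :=
  @Bigraph (lnode G + V4)%type (rnode (pendant G))
    ([set (inl e.1, e.2) | e in edges (pendant G)] :|:
     [set (inr p.1, p.2) | p : V4 * rnode (pendant G)]).

Lemma pendant_edge_subproof (G : bigraph) (e : edge G) :
  ((val e).1, inl (val e).2) \in edges (pendant G).
Proof. by apply/setUP; left; apply: imset_f (valP e). Qed.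

Definition pendant_edge (G : bigraph) (e : edge G) : edge (pendant G) :=
  exist _ ((val e).1, inl (val e).2) (pendant_edge_subproof e).

Lemma completion_edge_subproof (G : bigraph) (V4 : finType)
    (e : edge (pendant G)) :
  (inl (val e).1, (val e).2) \in edges (completion G V4).
Proof. by apply/setUP; left; apply: imset_f (valP e). Qed.

Definition completion_edge (G : bigraph) (V4 : finType) (e : edge G) :
    edge (completion G V4) :=
  exist _ (inl (val e).1, inl (val e).2)
    (completion_edge_subproof V4 (pendant_edge e)).

(* Main.v *)
Require Import Defs.
From mathcomp Require Import all_boot all_order all_algebra.

Set Implicit Arguments.
Unset Strict Implicit.
Unset Printing Implicit Defensive.

Import Order.TTheory GRing.Theory Num.Theory.

Local Open Scope ring_scope.

(** A perfect matching is the graph of an injection f from the left nodes to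
    the right nodes that follows edges.  On G' such an f is determined by its
    restriction x to G: the nodes left unmatched by x go to their pendants.
    On G'' the restriction of f to V_1 is again determined by x, while on V_4
    it is an arbitrary injection into the #V_4 right nodes that remain free,
    so every matching x has the same number (#V_4)! of extensions.  New edges
    have weight 1, hence all these extensions have the weight of x, and the
    number of extensions cancels against the normalising constant. *)

(** * Matchings, weights, and push-forwards with fibres of constant size *)

Lemma matchingP {G : bigraph} {x : config G} :
  reflect (forall v e e', incident v e -> incident v e' -> x e -> x e' -> e = e')
          (matching x).
Proof.
apply: (iffP forallP) => [xM v e e' ve ve' xe xe' | xM v].
  by have /card_le1_eqP := xM v; apply; rewrite inE ?ve ?ve'.
apply/card_le1_eqP => e e'; rewrite !inE => /andP[ve xe] /andP[ve' xe'].
exact: (xM v).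
Qed.

(** Edges outside the range of [iota] have the default weight 1 and drop out of the product; the
    others are reindexed by their unique preimage. *)
Lemma weight_extend (R : realFieldType) (G H : bigraph) (iota : edge G -> edge H)
    (lam : edge G -> R) (y : config H) :
  injective iota ->
  weight (extend_weight iota lam) y = weight lam (restrict iota y).
Proof.
move=> iota_inj; rewrite /weight (bigID (mem (codom iota))) /=.
rewrite [X in _ * X]big1 ?mulr1; last first.
  move=> e /andP[_ eN]; rewrite /extend_weight; case: pickP => // e' /eqP e'E.
  by rewrite -e'E codom_f in eN.
rewrite (eq_bigl (fun e => (e \in iota @: [set: edge G]) && y e)); last first.
  move=> e; rewrite andbC; congr (_ && _); apply/codomP/imsetP => [[e' ->]|[e' _ ->]].
    by exists e'.
  by exists e'.
rewrite big_mkcondr big_imset /=; last by move=> e e' _ _; apply: iota_inj.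
rewrite [RHS]big_mkcond; apply: eq_big => [e|e _]; first by rewrite inE.
rewrite ffunE /extend_weight; case: pickP => [e' /eqP/iota_inj -> //|/(_ e)].
by rewrite eqxx.
Qed.

Lemma pushforward_fibers (R : realFieldType) (G H : bigraph)
    (iota : edge G -> edge H) (lam : edge G -> R) (k : nat) :
  injective iota -> (0 < k)%N ->
  (forall x : config G,
     #|[set y | perfect_matching y & restrict iota y == x]| = (matching x * k)%N) ->
  forall x : config G,
    pushforward (restrict iota)
      (perfect_matching_distr (extend_weight iota lam)) x
    = matching_distr lam x.
Proof.
move=> iota_inj k_gt0 cardk.
have fiber x : \sum_(y : config H | perfect_matching y && (restrict iota y == x))
    weight (extend_weight iota lam) y
    = (if matching x then weight lam x else 0) *+ k.
  rewrite (eq_bigr (fun=> weight lam x)); last first.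
    by move=> y /andP[_ /eqP yx]; rewrite weight_extend // yx.
  rewrite sumr_const -cardsE cardk; case: (matching x); first by rewrite mul1n.
  by rewrite mul0rn.
have total : \sum_(y : config H | perfect_matching y)
    weight (extend_weight iota lam) y
    = (\sum_(x : config G | matching x) weight lam x) *+ k.
  (* The sum is grouped by restriction; fibres over non-matchings are empty and contribute 0. *)
  rewrite (partition_big (restrict iota) predT) //= [in RHS]big_mkcond -sumrMnl.
  by apply: eq_bigr => x _; apply: fiber.
move=> x; rewrite /pushforward /perfect_matching_distr /matching_distr.
rewrite /weighted_distr -big_mkcondr /=.
rewrite (eq_bigl _ _ (fun y => andbC _ _)) -mulr_suml fiber total.
case: (matching x); last by rewrite mul0rn mul0r.
(* The quotient k/k is split off and equals 1. If the normalising constant is 0, both sides are 0,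
   since the inverse of 0 is 0. *)
by rewrite -[X in X / _ = _]mulr_natr -[X in _ / X = _]mulr_natr -mulf_div
           divff ?mulr1 // pnatr_eq0 -lt0n.
Qed.

(** * Perfect matchings as injections along edges *)

Definition saturating (H : bigraph) (f : {ffun lnode H -> rnode H}) : bool :=
  injectiveb f && [forall a, (a, f a) \in edges H].

Definition graph_config (H : bigraph) (f : {ffun lnode H -> rnode H}) : config H :=
  [ffun e => f (val e).1 == (val e).2].
Arguments graph_config {H} f.

Lemma saturatingP {H : bigraph} {f : {ffun lnode H -> rnode H}} :
  reflect (injective f /\ forall a, (a, f a) \in edges H) (saturating f).
Proof.
by apply: (iffP andP) => -[] => [/injectiveP ? /forallP|/injectiveP ? ?];
  split => //; apply/forallP.
Qed.

Lemma graph_config_perfect (H : bigraph) (f : {ffun lnode H -> rnode H}) :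
  saturating f -> perfect_matching (graph_config f).
Proof.
case/saturatingP => f_inj fE.
have fM : matching (graph_config f).
  apply/matchingP => -[a|b] [[a1 b1] ?] [[a2 b2] ?] /= /eqP e1 /eqP e2;
    rewrite !ffunE /= => /eqP f1 /eqP f2; apply: val_inj => /=.
    by rewrite -f1 -f2 e1 e2.
  by move: f1 f2; rewrite e1 e2 => <- /f_inj ->.
rewrite /perfect_matching fM /=; apply/forallP => a; rewrite eqn_leq.
move/forallP: (fM) => -> /=; apply/card_gt0P.
by exists (exist _ (a, f a) (fE a)); rewrite inE /= ffunE /= !eqxx.
Qed.

(** Saturation matters here: a value [f a] not joined to [a] would leave no trace in
    [graph_config f]. *)
Lemma graph_config_inj (H : bigraph) :
  {in @saturating H &, injective graph_config}.
Proof.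
move=> f g /saturatingP[_ fE] _ /ffunP fg; apply/ffunP => a.
by have := fg (exist _ (a, f a) (fE a)); rewrite !ffunE /= eqxx => /esym/eqP.
Qed.

(** Degree one at a left node supplies the value of [f] and shows that [y] selects no other edge
    there; degree at most one at the right nodes makes [f] injective. *)
Lemma perfect_matching_graph (H : bigraph) (y : config H) :
  perfect_matching y -> exists2 f, saturating f & y = graph_config f.
Proof.
case/andP => /matchingP yM /forallP y1.
have ex a : exists b, [exists e : edge H, (val e == (a, b)) && y e].
  have /card_gt0P[e] : (0 < degree y (inl a))%N by rewrite (eqP (y1 a)).
  rewrite inE /= => /andP[/eqP ea ye].
  by exists (val e).2; apply/existsP; exists e; rewrite -ea -surjective_pairing eqxx.
pose f := [ffun a => xchoose (ex a)].
have fP a : exists2 e : edge H, val e = (a, f a) & y e.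
  by rewrite ffunE; have /existsP[e /andP[/eqP ? ?]] := xchooseP (ex a); exists e.
exists f.
  apply/saturatingP; split=> [a a' faa'|a]; last first.
    by case: (fP a) => e <- _; apply: valP.
  case: (fP a) (fP a') => e eE ye [e' e'E ye'].
  have ee' : e = e' by apply: (yM (inr (f a))) => //=; rewrite ?eE ?e'E /= ?faa'.
  by move: eE; rewrite ee' e'E => -[].
apply/ffunP => e; rewrite ffunE; have [e' e'E ye'] := fP (val e).1.
apply/idP/eqP => [ye|fe].
  have ee' : e = e' by apply: (yM (inl (val e).1)) => //=; rewrite e'E.
  by rewrite {2}ee' e'E.
suff -> : e = e' by [].
by apply: val_inj; rewrite e'E fe -surjective_pairing.
Qed.

Lemma card_perfect_fiber (G H : bigraph) (iota : edge G -> edge H) (x : config G) :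
  #|[set y | perfect_matching y & restrict iota y == x]|
  = #|[set f | saturating f & restrict iota (graph_config f) == x]|.
Proof.
rewrite -(card_in_imset (f := graph_config)); last first.
  by move=> f g; rewrite !inE => /andP[fS _] /andP[gS _]; apply: graph_config_inj.
apply: eq_card => y; rewrite !inE; apply/andP/imsetP => [[yP yx]|[f]].
  by have [f fS yf] := perfect_matching_graph yP; exists f; rewrite // inE fS -yf.
by rewrite inE => /andP[fS fx] ->; split=> //; apply: graph_config_perfect.
Qed.

(** * Edges of the two extensions, and the fibres for [pendant G] *)

Lemma pendant_edge_inj (G : bigraph) : injective (@pendant_edge G).
Proof. by move=> [[a b] ?] [[c d] ?] [ac bd]; apply: val_inj; rewrite /= ac bd. Qed.

Lemma completion_edge_inj (G : bigraph) (V4 : finType) :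
  injective (@completion_edge G V4).
Proof. by move=> [[a b] ?] [[c d] ?] [ac bd]; apply: val_inj; rewrite /= ac bd. Qed.

Lemma mem_pendant_inl (G : bigraph) a b :
  ((a, inl b) \in edges (pendant G)) = ((a, b) \in edges G).
Proof.
rewrite inE orbC; case: imsetP => [[? _ []]//|_] /=.
apply/imsetP/idP => [[[c d] cd [-> ->]]//|ab]; by exists (a, b).
Qed.

Lemma mem_pendant_inr (G : bigraph) a c :
  ((a, inr c) \in edges (pendant G)) = (a == c).
Proof.
rewrite inE; case: imsetP => [[? _ []]//|_] /=.
by apply/imsetP/eqP => [[i _ [-> ->]]//|->]; exists c.
Qed.

Lemma mem_completion_inl (G : bigraph) (V4 : finType) a r :
  ((inl a, r) \in edges (completion G V4)) = ((a, r) \in edges (pendant G)).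
Proof.
rewrite inE orbC; case: imsetP => [[? _ []]//|_] /=.
apply/imsetP/idP => [[[c d] cd [-> ->]]//|ar]; by exists (a, r).
Qed.

Lemma mem_completion_inr (G : bigraph) (V4 : finType) c r :
  (inr c, r) \in edges (completion G V4).
Proof. by apply/setUP; right; apply/imsetP; exists (c, r). Qed.

(** The unique extension of a matching [x] to G'. For other [x] the pick may be ambiguous, so the
    value is only meaningful alongside [matching x]. *)
Definition partner (G : bigraph) (x : config G) : {ffun lnode G -> rnode (pendant G)} :=
  [ffun a => if [pick e | ((val e).1 == a) && x e] is Some e
             then inl (val e).2 else inr a].

Lemma saturating_pendant_fiber (G : bigraph) (x : config G)
    (f : {ffun lnode (pendant G) -> rnode (pendant G)}) :
  saturating f && (restrict (@pendant_edge G) (graph_config f) == x)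
  = matching x && (f == partner x).
Proof.
apply/andP/andP => [[/saturatingP[f_inj fE] /eqP fx]|[/matchingP xM /eqP ->]].
  have xE e : x e = (f (val e).1 == inl (val e).2) by rewrite -fx !ffunE.
  split.
    apply/matchingP => -[a|b] [[a1 b1] ?] [[a2 b2] ?] /= /eqP e1 /eqP e2;
      rewrite !xE /= => /eqP f1 /eqP f2; apply: val_inj => /=.
      by move: f2; rewrite e1 e2 -e1 f1 => -[->].
    by rewrite e1 e2 (f_inj a1 a2) // f1 f2 e1 e2.
  apply/eqP/ffunP => a; rewrite ffunE; case: pickP => [e|noe].
    by rewrite xE => /andP[/eqP <- /eqP].
  (* With no edge of [x] at [a], a value in V_2 would itself be an edge selected by [x], and the
     only node of V_3 joined to [a] is its own pendant. *)
  have := fE a; case fa: (f a) => [b|c].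
    rewrite mem_pendant_inl => ab; have := noe (exist _ (a, b) ab).
    by rewrite xE /= fa !eqxx.
  by rewrite mem_pendant_inr => /eqP ->.
split.
  apply/saturatingP; split=> [a a'|a]; rewrite !ffunE.
    case: pickP => [e /andP[/eqP <- xe]|_];
      case: pickP => [e' /andP[/eqP <- xe']|_] // [] // ee'.
    by rewrite (xM (inr (val e).2) e e') //= ee'.
  case: pickP => [e /andP[/eqP <- _]|_]; last by rewrite mem_pendant_inr.
  by rewrite mem_pendant_inl -surjective_pairing; apply: valP.
apply/eqP/ffunP => e; rewrite !ffunE /=; case: pickP => [e' /andP[/eqP e'e xe']|noe].
  apply/eqP/idP => [[e'e2]|xe]; last by rewrite (xM (inl (val e).1) e e') //= e'e.
  suff -> : e = e' by [].
  by apply: val_inj; rewrite [LHS]surjective_pairing [RHS]surjective_pairing e'e e'e2.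
by have := noe e; rewrite eqxx /= => ->.
Qed.

Lemma card_pendant_fiber (G : bigraph) (x : config G) :
  #|[set y | perfect_matching y & restrict (@pendant_edge G) y == x]|
  = (matching x * 1)%N.
Proof.
rewrite card_perfect_fiber muln1.
under eq_finset do rewrite saturating_pendant_fiber.
case: (matching x) => /=; last by rewrite (eq_card0 (fun _ => in_set0 _)).
by rewrite -[RHS](cards1 (partner x)); apply: eq_card => f; rewrite !inE.
Qed.

(** * Fibres for [completion G V4] *)

Definition glue (A B C : finType) (p : {ffun A -> C} * {ffun B -> C}) :
    {ffun A + B -> C} :=
  [ffun v => match v with inl a => p.1 a | inr b => p.2 b end].

Lemma glue_inj (A B C : finType) : injective (@glue A B C).
Proof.
move=> [f g] [f' g'] /ffunP fg; congr pair; apply/ffunP => v.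
  by have := fg (inl v); rewrite !ffunE.
by have := fg (inr v); rewrite !ffunE.
Qed.

Lemma glue_surj (A B C : finType) (h : {ffun A + B -> C}) :
  h = glue ([ffun a => h (inl a)], [ffun b => h (inr b)]).
Proof. by apply/ffunP => -[a|b]; rewrite !ffunE. Qed.

(** With [f] fixed, the conditions on [g] take the form counted by [card_inj_ffuns_on]. *)
Lemma glue_injectiveb (A B C : finType) (f : {ffun A -> C}) (g : {ffun B -> C}) :
  injectiveb (glue (f, g))
  = injectiveb f && (injectiveb g && (g \in ffun_on (~: (f @: A)))).
Proof.
apply/injectiveP/and3P => [h_inj|[/injectiveP f_inj /injectiveP g_inj /ffun_onP gf]].
  split.
  - by apply/injectiveP => a a' faa'; have := h_inj (inl a) (inl a'); rewrite !ffunE => /(_ faa')[].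
  - by apply/injectiveP => b b' gbb'; have := h_inj (inr b) (inr b'); rewrite !ffunE => /(_ gbb')[].
  apply/ffun_onP => b; rewrite inE; apply/imsetP => -[a _ gf].
  by have := h_inj (inl a) (inr b); rewrite !ffunE /= gf => /(_ erefl).
have fg a b : f a <> g b.
  by move=> ab; have := gf b; rewrite inE -ab imset_f.
move=> [a|b] [a'|b']; rewrite !ffunE /=.
- by move/f_inj ->.
- by move/fg.
- by move/esym/fg.
- by move/g_inj ->.
Qed.

(** Nodes of V_4 are joined to every right node, so following edges constrains only [f], and the
    restriction to G sees only [f]; what remains for [f] is the fibre condition on G'. *)
Lemma saturating_completion_fiber (G : bigraph) (V4 : finType) (x : config G)
    (f : {ffun lnode G -> rnode (pendant G)}) (g : {ffun V4 -> rnode (pendant G)}) :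
  @saturating (completion G V4) (glue (f, g))
    && (restrict (@completion_edge G V4)
          (@graph_config (completion G V4) (glue (f, g))) == x)
  = [&& matching x, f == partner x, injectiveb g &
        g \in ffun_on (~: (f @: lnode G))].
Proof.
rewrite /saturating glue_injectiveb.
have -> : [forall v, (v, glue (f, g) v) \in edges (completion G V4)]
          = [forall a, (a, f a) \in edges (pendant G)].
  apply/forallP/forallP => [fE a|fE [a|c]].
  - by have := fE (inl a); rewrite ffunE mem_completion_inl.
  - by rewrite ffunE mem_completion_inl.
  - exact: mem_completion_inr.
have -> : restrict (@completion_edge G V4)
            (@graph_config (completion G V4) (glue (f, g)))
          = restrict (@pendant_edge G) (@graph_config (pendant G) f).
  by apply/ffunP => e; rewrite !ffunE.
rewrite [RHS]andbA -saturating_pendant_fiber /saturating.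
by rewrite -!andbA; do !bool_congr.
Qed.

Lemma card_completion_fiber (G : bigraph) (V4 : finType) (x : config G) :
  #|V4| = #|rnode G| ->
  #|[set y | perfect_matching y & restrict (@completion_edge G V4) y == x]|
  = (matching x * #|V4|`!)%N.
Proof.
move=> cardV4; rewrite card_perfect_fiber.
set D := [set g : {ffun V4 -> rnode (pendant G)} |
           g \in ffun_on (~: (partner x @: lnode G)) & injectiveb g].
(* Keeping [matching x] in the filter treats both cases at once: the set is empty when [x] is not a
   matching. *)
transitivity #|[set glue (partner x, g) | g in D & matching x]|.
  apply: eq_card => h; rewrite [h]glue_surj inE saturating_completion_fiber.
  apply/and4P/imsetP => [[xM /eqP -> gI gD]|[g]].
    by eexists; last reflexivity; rewrite inE xM andbT in_set gI gD.
  rewrite inE in_set => /andP[/andP[gD gI] xM] /glue_inj[-> ->].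
  by rewrite eqxx.
rewrite card_imset; last by move=> g g' /glue_inj[].
case xM: (matching x); last first.
  by apply: eq_card0 => g; rewrite !inE andbF.
(* The fibre characterisation on G', read backwards, gives injectivity of [partner x]. *)
have /andP[/saturatingP[p_inj _] _] :
    @saturating (pendant G) (partner x)
      && (restrict (@pendant_edge G) (@graph_config (pendant G) (partner x)) == x).
  by rewrite saturating_pendant_fiber xM eqxx.
(* Of the #V_2 + #V_1 right nodes, [partner x] occupies exactly #V_1. *)
have free : #|~: (partner x @: lnode G)| = #|V4|.
  rewrite cardsCs setCK card_imset // card_sum cardV4.
  by rewrite addnK.
(* The factorial is rewritten as a falling factorial with equal arguments, which counts injections
   between sets of equal size. *)
rewrite mul1n -ffactnn -{1}free -card_inj_ffuns_on.
by apply: eq_card => g; rewrite !inE andbT.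
Qed.

Theorem mainTheorem7 (R : realFieldType) (G : bigraph) (lam : edge G -> R)
    (lam_ge0 : forall e : edge G, 0 <= lam e)
    (V4 : finType) (card_V4 : #|V4| = #|rnode G|) :
  (forall x : config G,
     pushforward (restrict (@pendant_edge G))
       (perfect_matching_distr (extend_weight (@pendant_edge G) lam)) x
     = matching_distr lam x)
  /\
  (balanced (completion G V4) /\
   forall x : config G,
     pushforward (restrict (@completion_edge G V4))
       (perfect_matching_distr (extend_weight (@completion_edge G V4) lam)) x
     = matching_distr lam x).
Proof.
split; last split.
- apply: (@pushforward_fibers _ _ _ _ _ 1) => //; first exact: pendant_edge_inj.
  exact: card_pendant_fiber.
- by rewrite /balanced /= !card_sum card_V4 addnC.
- apply: (@pushforward_fibers _ _ _ _ _ #|V4|`!); first exact: completion_edge_inj.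
    exact: fact_gt0.
  by move=> x; apply: card_completion_fiber.
Qed.
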